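(* Let $N\ge2$ and let $\mu$ and $\mu'$ be two quasi-stationary Markov measures on $\mathcal K_N$ associated to $(\lambda,T)$ and $(\lambda',T')$ respectively. Let $\pi(\mathcal O_N)=(S_i)_{i\in\mathbb Z_N}$ and $\pi'(\mathcal O_N)=(S_i')_{i\in\mathbb Z_N}$ be the two associated representations of the Cuntz algebra $\mathcal O_N$. Suppose that for every $i,j\in\mathbb Z_N$, $$\sum_{n=1}^\infty\left|T^{(n)}_{i,j}-T'^{(n)}_{i,j}\right|<\infty.$$ Then the measures $\mu$ and $\mu'$ are equivalent, and the representations $\pi(\mathcal O_N)$ and $\pi'(\mathcal O_N)$ are also equivalent.
   Context: $\mathbb N=\{1,2,\dots\}$, $\mathbb Z_N=\{0,1,\dots,N-1\}$, and $\mathcal K_N=\mathbb Z_N^{\mathbb N}$ is the set of infinite words $x_1x_2\dots$ over $\mathbb Z_N$, with the product topology and Borel sigma-algebra. The shift is $\sigma(x_1x_2\dots)=x_2x_3\dots$. For a finite word $I=i_1\dots i_n$, the cylinder set is $\mathcal C(I)=\{x\in\mathcal K_N:x_1=i_1,\dots,x_n=i_n\}$. Markov measures: a matrix is stochastic if each row sums to $1$. Let $\lambda=(\lambda_0,\dots,\lambda_{N-1})$ be a row vector with $\lambda_i>0$ and $\sum_i\lambda_i=1$, and let $T=\{T^{(n)}\}_{n\in\mathbb N}$ be a sequence of stochastic $N\times N$ matrices with $T^{(n)}_{i,j}>0$ for all $i,j\in\mathbb Z_N$, $n\in\mathbb N$, and such that $\lambda T^{(1)}=\lambda$. The Markov measure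 associated to $(\lambda,T)$ is the unique Borel probability measure $\mu$ on $\mathcal K_N$ with $$\mu(\mathcal C(i_1\dots i_n))=\lambda_{i_1}T^{(1)}_{i_1,i_2}T^{(2)}_{i_2,i_3}\cdots T^{(n-1)}_{i_{n-1},i_n}$$ for all finite words. It is quasi-stationary if $$\sum_{n=1}^\infty\left|\frac{T^{(n)}_{x_n,x_{n+1}}}{T^{(n+1)}_{x_n,x_{n+1}}}-1\right|<\infty\quad\text{for all }x_1x_2\dots\in\mathcal K_N.$$ Associated representation: a representation of the Cuntz algebra $\mathcal O_N$ on a Hilbert space is given by operators $(S_i)_{i\in\mathbb Z_N}$ with $S_i^*S_j=\delta_{ij}I$ and $\sum_{i}S_iS_i^*=I$. The representation associated to the quasi-stationary Markov measure $\mu$ with data $(\lambda,T)$ is the one on $L^2(\mu)$ given by $S_jf=f_j\,(f\circ\sigma)$, where $$f_j(x_1x_2\dots)=\delta_{j,x_1}\sqrt{\frac{\lambda_{x_2}}{\lambda_{x_1}T^{(1)}_{x_1,x_2}}F(x_2x_3\dots)},\qquad F(x_1x_2\dots)=\prod_{n=1}^\infty\frac{T^{(n)}_{x_n,x_{n+1}}}{T^{(n+1)}_{x_n,x_{n+1}}}$$ (the product converges to a number in $(0,\infty)$, and the $S_j$ do form a representation of $\mathcal O_N$). Two measures are equivalent if they are mutually absolutely continuous. Two representations $(S_i)$ on $\mathcal H$ and $(S_i')$ on $\mathcal H'$ are equivalent if there is a unitary $W:\mathcal H\to\mathcal H'$ with $WS_i=S_i'W$ for all $i$. *)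

(* Defs.v *)
From HB Require Import structures.
From mathcomp Require Import all_boot all_order all_algebra.
From mathcomp Require Import complex ring_quotient sesquilinear.
From mathcomp Require Import all_classical all_reals all_analysis.

Set Implicit Arguments.
Unset Strict Implicit.
Unset Printing Implicit Defensive.
Import Order.TTheory GRing.Theory Num.Theory.
Import numFieldNormedType.Exports.

Local Open Scope classical_set_scope.
Local Open Scope ring_scope.
Local Open Scope complex_scope.
Local Open Scope quotient_scope.

Section L2.
Context d (T : measurableType d) (R : realType).
Variable mu : {measure set T -> \bar R}.
Local Notation C := R[i].
Local Notation Re := (@complex.Re R).
Local Notation Im := (@complex.Im R).

(* A complex function f is in L^2 iff it is measurable and |f|^2 is integrable,
   i.e., iff Re f and Im f are in the real L^2. *)
Definition sq_integrable : {pred T -> C} :=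
  [pred f | (Re \o f \in Lfun mu 2%:E) && (Im \o f \in Lfun mu 2%:E)].

Lemma sq_integrable_submod : submod_closed sq_integrable.
Proof.
have [L0 LP] := @Lfun_submod_closed _ _ _ mu 2%:E (lee1n 2).
have LZ a f : f \in Lfun mu 2%:E -> a *: f \in Lfun mu 2%:E.
  by move=> Lf; rewrite -[_ *: _]addr0; exact: LP.
split=> [|a f g /andP[fr fi] /andP[gr gi]].
  by rewrite inE; apply/andP; split; exact: L0.
rewrite inE; apply/andP; split.
- rewrite (_ : _ \o _ = Re a *: (Re \o f : T -> R) +
      ((- Im a) *: (Im \o f : T -> R) + (Re \o g : T -> R))).
    by apply: (LP) => //; exact: LP.
  apply/funext => x; case: a => a b; rewrite /= !fctE.
  by case: (f x) => u v; case: (g x) => w z /=; rewrite addrA -mulNr.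
- rewrite (_ : _ \o _ = Re a *: (Im \o f : T -> R) +
      (Im a *: (Re \o f : T -> R) + (Im \o g : T -> R))).
    by apply: (LP) => //; exact: LP.
  apply/funext => x; case: a => a b; rewrite /= !fctE.
  by case: (f x) => u v; case: (g x) => w z /=; rewrite addrA.
Qed.

HB.instance Definition _ :=
  GRing.isSubmodClosed.Build C (T -> C) sq_integrable sq_integrable_submod.

Record L2fun : Type := MkL2fun {
  L2fun_val :> T -> C ;
  L2fun_sq_integrable : L2fun_val \in sq_integrable }.

HB.instance Definition _ := [isSub for L2fun_val].
HB.instance Definition _ := [Choice of L2fun by <:].
HB.instance Definition _ := [SubChoice_isSubLmodule of L2fun by <:].

Definition null_L2fun : {pred L2fun} :=
  [pred f : L2fun | `[< {ae mu, forall x, f x = 0} >]].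

Lemma null_L2fun_submod : submod_closed null_L2fun.
Proof.
split=> [|a f g /asboolP f0 /asboolP g0]; apply/asboolP.
  by apply: aeW => x.
by move: f0 g0; apply: filterS2 => x /= f0 g0; rewrite !fctE f0 g0 scaler0 addr0.
Qed.

HB.instance Definition _ :=
  GRing.isSubmodClosed.Build C L2fun null_L2fun null_L2fun_submod.

(* ring_quotient's [ideal_quot] is the quotient by an additive subgroup; the
   module structure is added below. *)
Definition L2 : Type := {ideal_quot null_L2fun}.

HB.instance Definition _ := GRing.Zmodule.on L2.
HB.instance Definition _ := EqQuotient.on L2.

Definition L2_repr (u : L2) : T -> C := repr u.
Coercion L2_repr : L2 >-> Funclass.

Lemma L2_piP (f g : L2fun) :
  reflect {ae mu, forall x, f x = g x} (\pi_L2 f == \pi_L2 g).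
Proof.
rewrite -Quotient.idealrBE.
apply: (iffP (asboolP _)); apply: filterS => x /=.
  by rewrite !fctE => /eqP; rewrite subr_eq0 => /eqP.
by rewrite !fctE => ->; rewrite subrr.
Qed.

Lemma L2_reprP (f : L2fun) : {ae mu, forall x, (\pi_L2 f : L2) x = f x}.
Proof. by apply/L2_piP; rewrite reprK. Qed.

Definition L2_scale (a : C) (u : L2) : L2 := \pi_L2 (a *: repr u).

Lemma L2_scale_pi a (f : L2fun) : L2_scale a (\pi_L2 f) = \pi_L2 (a *: f).
Proof.
apply/eqP/L2_piP; have := L2_reprP f; apply: filterS => x.
by rewrite /L2_repr /= !fctE => ->.
Qed.

Lemma L2_piW (P : L2 -> Prop) : (forall f, P (\pi_L2 f)) -> forall u, P u.
Proof. by move=> Ppi u; rewrite -[u]reprK. Qed.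

Lemma L2_piD (f g : L2fun) : \pi_L2 (f + g) = (\pi_L2 f : L2) + \pi_L2 g.
Proof. exact: raddfD. Qed.

Fact L2_scalerA a b u : L2_scale a (L2_scale b u) = L2_scale (a * b) u.
Proof. by elim/L2_piW: u => f; rewrite !L2_scale_pi scalerA. Qed.

Fact L2_scale1r : left_id 1 L2_scale.
Proof. by elim/L2_piW=> f; rewrite L2_scale_pi scale1r. Qed.

Fact L2_scalerDr : right_distributive L2_scale +%R.
Proof.
move=> a; elim/L2_piW=> f; elim/L2_piW=> g.
by rewrite -L2_piD !L2_scale_pi scalerDr L2_piD.
Qed.

Fact L2_scalerDl u : {morph L2_scale^~ u : a b / a + b}.
Proof. by elim/L2_piW: u => f a b; rewrite !L2_scale_pi scalerDl L2_piD. Qed.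

HB.instance Definition _ := GRing.Zmodule_isLmodule.Build C L2
  L2_scalerA L2_scale1r L2_scalerDr L2_scalerDl.


Definition cintegral (h : T -> C) : C :=
  (\int[mu]_x Re (h x))%R +i* (\int[mu]_x Im (h x))%R.

(* Linear in the first argument, conjugate-linear in the second one. *)
Definition L2_dot (u v : L2) : C := cintegral (fun x => u x * (v x)^*).

Definition cintegrable (h : T -> C) :=
  mu.-integrable setT (EFin \o (Re \o h)) /\
  mu.-integrable setT (EFin \o (Im \o h)).

Fact cintegrableM (f g : L2fun) : cintegrable (fun x => f x * (g x)^*).
Proof.
have /andP[fr fi] := L2fun_sq_integrable f.
have /andP[gr gi] := L2fun_sq_integrable g.
have intM h k : h \in Lfun mu 2%:E -> k \in Lfun mu 2%:E ->
    mu.-integrable setT (EFin \o (h \* k)).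
  by move=> Lh Lk; apply/Lfun1_integrable; exact: Lfun2_mul_Lfun1.
split.
- have := integrableD measurableT (intM _ _ fr gr) (intM _ _ fi gi).
  apply: eq_integrable => // x _ /=.
  by case: (f x) (g x) => [a b] [w z] /=; rewrite mulrN opprK.
- have := integrableB measurableT (intM _ _ fi gr) (intM _ _ fr gi).
  apply: eq_integrable => // x _ /=.
  by case: (f x) (g x) => [a b] [w z] /=; rewrite mulrN addrC.
Qed.

Fact cintegralP a (h k : T -> C) : cintegrable h -> cintegrable k ->
  cintegral (fun x => a * h x + k x) = a * cintegral h + cintegral k.
Proof.
move=> [hr hi] [kr ki]; case: a => a b; rewrite /cintegral.
have ZI r g : mu.-integrable setT (EFin \o g) ->
    mu.-integrable setT (EFin \o (fun x => r * g x)).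
  move=> ig; have := integrableZl measurableT r ig.
  by apply: eq_integrable => // x _ /=.
have DI g g' : mu.-integrable setT (EFin \o g) ->
    mu.-integrable setT (EFin \o g') ->
    mu.-integrable setT (EFin \o (fun x => g x + g' x)).
  move=> ig ig'; have := integrableD measurableT ig ig'.
  by apply: eq_integrable => // x _ /=.
set hR := fun x => Re (h x); set hI := fun x => Im (h x).
set kR := fun x => Re (k x); set kI := fun x => Im (k x).
have -> : (fun x => Re ((a +i* b) * h x + k x)) =
    (fun x => (a * hR x + (- b) * hI x) + kR x).
  apply/funext => x; rewrite /hR /hI /kR.
  by case: (h x) (k x) => [? ?] [? ?] /=; rewrite mulNr.
have -> : (fun x => Im ((a +i* b) * h x + k x)) =
    (fun x => (a * hI x + b * hR x) + kI x).
  apply/funext => x; rewrite /hR /hI /kI.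
  by case: (h x) (k x) => [? ?] [? ?].
rewrite !RintegralD ?RintegralZl//;
  do ?[exact: ZI | by apply: DI; exact: ZI].
by rewrite mulNr.
Qed.

Lemma L2_dot_pi (f g : L2fun) :
  L2_dot (\pi_L2 f) (\pi_L2 g) = cintegral (fun x => f x * (g x)^*).
Proof.
have [r1 i1] := cintegrableM (repr (\pi_L2 f)) (repr (\pi_L2 g)).
have [r2 i2] := cintegrableM f g.
have ae : {ae mu, forall x, (\pi_L2 f : L2) x * ((\pi_L2 g : L2) x)^* =
    f x * (g x)^*}.
  by have := L2_reprP g; have := L2_reprP f; apply: filterS2 => x -> ->.
rewrite /L2_dot /cintegral /Rintegral; congr (fine _ +i* fine _).
- apply: ae_eq_integral => //; [exact: measurable_int r1|
    exact: measurable_int r2|].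
  by move: ae; apply: filterS => x h _; congr (Re _)%:E.
- apply: ae_eq_integral => //; [exact: measurable_int i1|
    exact: measurable_int i2|].
  by move: ae; apply: filterS => x h _; congr (Im _)%:E.
Qed.

Fact L2_dotPl (v : L2) a (u w : L2) :
  L2_dot (a *: u + w) v = a * L2_dot u v + L2_dot w v.
Proof.
elim/L2_piW: v => g; elim/L2_piW: u => f; elim/L2_piW: w => h.
have -> : a *: (\pi_L2 f : L2) = \pi_L2 (a *: f) by rewrite -L2_scale_pi.
rewrite -L2_piD !L2_dot_pi -cintegralP; try exact: cintegrableM.
by congr cintegral; apply/funext => x; rewrite mulrA -mulrDl.
Qed.

Fact L2_dotC (u v : L2) : L2_dot u v = (L2_dot v u)^*.
Proof.
rewrite /L2_dot /cintegral /=; congr (_ +i* _).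
  apply: eq_Rintegral => x _; case: (u x) (v x) => [a b] [c e] /=.
  by rewrite mulrC [b * _]mulrC !mulrN mulNr.
rewrite -mulN1r -RintegralZl//; last by case: (cintegrableM (repr v) (repr u)).
apply: eq_Rintegral => x _; case: (u x) (v x) => [a b] [c e] /=.
by rewrite mulN1r !mulrN opprD opprK addrC [b * _]mulrC [a * _]mulrC.
Qed.

Fact L2_dotPr (u : L2) a (v w : L2) :
  L2_dot u (a *: v + w) = a^* * L2_dot u v + L2_dot u w.
Proof.
by rewrite L2_dotC L2_dotPl [L2_dot u v]L2_dotC [L2_dot u w]L2_dotC rmorphD
  rmorphM.
Qed.

Fact L2_dot_bilinear : bilinear_for *%R (@conjc R \; *%R) L2_dot.
Proof. by split=> [v a u w|u a v w]; [exact: L2_dotPl | exact: L2_dotPr]. Qed.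

HB.instance Definition _ := bilinear_isBilinear.Build C L2 L2 C *%R
  (@conjc R \; *%R) L2_dot L2_dot_bilinear.

HB.instance Definition _ := isHermitianSesquilinear.Build C L2 false
  (@conjc R) L2_dot (fun u v => etrans (L2_dotC u v) (esym (mul1r _))).

Fact L2_dot_gt0 (u : L2) : u != 0 -> 0 < L2_dot u u.
Proof.
have [r0 i0] := cintegrableM (repr u) (repr u).
have uuE x : u x * (u x)^* = (Re (u x) ^+ 2 + Im (u x) ^+ 2) +i* 0.
  case: (u x) => a b; apply/eqP; rewrite eq_complex /=; apply/andP; split.
    by rewrite mulrN opprK !expr2.
  by rewrite mulrN [b * _]mulrC addNr.
have ge0 x : 0 <= Re (u x * (u x)^*).
  by rewrite uuE /= addr_ge0// sqr_ge0.
move=> u0; rewrite ltcE; apply/andP; split.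
  apply/eqP; rewrite /L2_dot /cintegral /= /Rintegral integral0_eq// => x _.
  by rewrite uuE.
rewrite lt0r Rintegral_ge0// andbT; apply: contra u0 => /eqP int0.
have -> : (0 : L2) = \pi_L2 0 by rewrite raddf0.
rewrite -[u]reprK; apply/L2_piP.
have : (\int[mu]_x `|(Re (u x * (u x)^*))%:E| = 0)%E.
  have := integrable_fin_num measurableT r0 => /fineK.
  rewrite [fine _]int0 => /esym; apply: etrans.
  by apply: eq_integral => x _; rewrite gee0_abs// lee_fin.
move/(ae_eq_integral_abs _ measurableT (measurable_int _ r0)).
apply: filterS => x /(_ Logic.I) /= [].
rewrite -/(u x) uuE /= => /eqP.
rewrite paddr_eq0 ?sqr_ge0// !sqrf_eq0 => /andP[/eqP re /eqP im].
by apply/eqP; rewrite eq_complex; apply/andP; split; apply/eqP.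
Qed.

HB.instance Definition _ := isDotProduct.Build C L2 L2_dot L2_dot_gt0.

End L2.

Section CuntzRepresentations.
Variable R : realType.

(* A representation of the Cuntz algebra O_N on (H, dot), where [rep_adj i] is
   the adjoint of [rep_op i].  The completeness of H is not recorded: it plays
   no role in the definitions below, and H is an L2 space in the applications.
   Boundedness of the operators follows from the relations. *)
Record cuntz_rep (N : nat) (H : lmodType R[i]) (dot : {dot H for @conjc R}) :=
  CuntzRep {
    rep_op :> 'I_N -> {linear H -> H} ;
    rep_adj : 'I_N -> {linear H -> H} ;
    rep_adjP : forall i u v, dot (rep_op i u) v = dot u (rep_adj i v) ;
    rep_adjK : forall i j u, rep_adj i (rep_op j u) = (i == j)%:R *: u ;
    rep_sum : forall u, \sum_i rep_op i (rep_adj i u) = u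
  }.

Definition unitary_op (H H' : lmodType R[i]) (dot : {dot H for @conjc R})
    (dot' : {dot H' for @conjc R}) (W : {linear H -> H'}) : Prop :=
  (forall u v, dot' (W u) (W v) = dot u v) /\ (forall v, exists u, W u = v).

Definition rep_equiv (N : nat) (H H' : lmodType R[i])
    (dot : {dot H for @conjc R}) (dot' : {dot H' for @conjc R})
    (S : cuntz_rep N dot) (S' : cuntz_rep N dot') : Prop :=
  exists2 W : {linear H -> H'},
    unitary_op dot dot' W & forall i u, W (S i u) = S' i (W u).

End CuntzRepresentations.

(* The alphabet Z_N is 'I_n.+1 with N = n.+1, because measurable types have to
   be inhabited. *)
Section Words.
Variable n : nat.

Definition word_space : Type :=
  prod_topology (fun _ : nat => discrete_topology 'I_n.+1).

HB.instance Definition _ := Topological.on word_space.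
HB.instance Definition _ := isPointed.Build word_space (fun=> ord0).

Definition words : Type := g_sigma_algebraType (@open word_space).

HB.instance Definition _ := Measurable.on words.

(* Positions are counted from 0: [letter x k] is x_(k+1). *)
Definition letter (x : words) (k : nat) : 'I_n.+1 := x k.

Definition wshift (x : words) : words := fun k => x k.+1.

Definition cylinder (m : nat) (w : m.-tuple 'I_n.+1) : set words :=
  [set x | forall k : 'I_m, letter x k = tnth w k].

End Words.

(* As for words, sequences of matrices are counted from 0: [T k] is T^(k+1). *)
Section Markov.
Variables (R : realType) (n : nat).
Implicit Types (l : 'rV[R]_n.+1) (T : nat -> 'M[R]_n.+1).
Implicit Types (mu : probability (words n) R).

Definition markov_data l T : Prop :=
  [/\ forall i, 0 < l 0 i, \sum_i l 0 i = 1,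
      forall k i j, 0 < T k i j, forall k i, \sum_j T k i j = 1
    & l *m T 0%N = l].

Definition markov_measure l T mu : Prop :=
  forall m (w : m.+1.-tuple 'I_n.+1),
    mu (cylinder w) =
      (l 0 (tnth w ord0) *
       \prod_(k < m) T k (tnth w (widen_ord (leqnSn m) k))
                         (tnth w (lift ord0 k)))%:E.

Definition markov_ratio T (x : words n) (k : nat) : R :=
  T k (letter x k) (letter x k.+1) / T k.+1 (letter x k) (letter x k.+1).

Definition quasi_stationary T : Prop :=
  forall x : words n, cvgn (series (fun k => `|markov_ratio T x k - 1|)).

(* The infinite product F. *)
Definition markov_F T (x : words n) : R :=
  limn (fun m => \prod_(0 <= k < m) markov_ratio T x k).

(* The functions f_j. *)
Definition markov_f l T (j : 'I_n.+1) (x : words n) : R :=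
  (j == letter x 0)%:R *
  Num.sqrt (l 0 (letter x 1)
              / (l 0 (letter x 0) * T 0%N (letter x 0) (letter x 1))
            * markov_F T (wshift x)).

(* S is the representation on L2 mu given by S_j f = f_j (f \o wshift). *)
Definition associated_rep l T mu
    (S : cuntz_rep n.+1 (@L2_dot _ (words n) R mu)) : Prop :=
  forall (j : 'I_n.+1) (f : L2 mu),
    {ae mu, forall x, (S j f : L2 mu) x = (markov_f l T j x)%:C * f (wshift x)}.

End Markov.

(* Main.v *)
(* By quasi-stationarity every entry T^(n)_ij has summable relative increments,
   so it stays above a positive constant, and likewise for T'.  The hypothesis
   then makes sum_n |ln (T'^(n)_ij / T^(n)_ij)| finite for all i, j, so the
   likelihood ratios mu'(C(x_1 ... x_m)) / mu(C(x_1 ... x_m)) are bounded and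
   converge pointwise to a positive function rho.  Dominated convergence on
   cylinders gives mu' = rho mu, hence equivalence, and W f = rho^(-1/2) f is a
   unitary from L^2(mu) onto L^2(mu').

   The identity W S_j = S'_j W amounts to
   f_j^2 (rho o sigma) = (f'_j)^2 rho, which is the limit of a trivial identity
   between cylinder weights because f_j(x)^2 is the limit of
   mu(C(x_2 ... x_m)) / mu(C(x_1 ... x_m)) when x_1 = j.  Since W f is
   only defined almost everywhere, it also needs sigma to be nonsingular for
   mu': the image of mu' under sigma is the Markov measure of the shifted
   sequence of matrices, which is absolutely continuous with respect to mu' by
   the same argument. *)

Require Import Defs.
From HB Require Import structures.
From mathcomp Require Import all_boot all_order all_algebra.
From mathcomp Require Import complex ring.
From mathcomp Require Import all_classical all_reals all_analysis.
From mathcomp Require Import measurable_realfun.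
Import Order.TTheory GRing.Theory Num.Theory.
Import numFieldNormedType.Exports.
Local Open Scope classical_set_scope.
Local Open Scope ring_scope.

Set Implicit Arguments.
Unset Strict Implicit.
Unset Printing Implicit Defensive.

(** * Summable sequences and infinite products *)

Section summable_sequences.
Variable R : realType.
Implicit Types u v t : nat -> R.

Lemma series_le_limn u : (forall k, 0 <= u k) -> cvgn (series u) ->
  forall m, series u m <= limn (series u).
Proof.
move=> u0 cu m; apply: nondecreasing_cvgn_le => //.
exact: nondecreasing_series.
Qed.

Lemma cvg_series_ubound u M : (forall k, 0 <= u k) ->
  (forall m, series u m <= M) -> cvgn (series u).
Proof.
move=> u0 uM; apply: nondecreasing_is_cvgn; first exact: nondecreasing_series.
by exists M => _ [m _ <-].
Qed.

Lemma cvg_series_sum (I : finType) (u : I -> nat -> R) :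
  (forall i k, 0 <= u i k) -> (forall i, cvgn (series (u i))) ->
  cvgn (series (fun k => \sum_i u i k)).
Proof.
move=> u0 cu; apply: (@cvg_series_ubound _ (\sum_i limn (series (u i)))).
  by move=> k; exact: sumr_ge0.
move=> m; rewrite /series /= exchange_big ler_sum// => i _.
exact: series_le_limn.
Qed.

(** The partial products are the exponentials of the partial sums of [ln (u k)], which converge
    absolutely; the limit is positive because it is an exponential. *)
Lemma prod_cvg u : (forall k, 0 < u k) ->
  cvgn (series (fun k => `|ln (u k)|)) ->
  exists2 p : R, 0 < p & (fun m => \prod_(0 <= k < m) u k) @ \oo --> p.
Proof.
move=> u0 /(@normed_cvg _ R^o (fun k => ln (u k))) cu.
exists (expR (limn (series (fun k => ln (u k))))); first exact: expR_gt0.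
rewrite (_ : (fun m => _) = (fun m => expR (series (fun k => ln (u k)) m))).
  by apply: continuous_cvg => //; exact: continuous_expR.
apply/funext => m; rewrite /series /= expR_sum.
by apply: eq_bigr => k _; rewrite lnK ?posrE.
Qed.

Lemma prod_le_series_ln u m : (forall k, 0 < u k) ->
  \prod_(0 <= k < m) u k <= expR (series (fun k => `|ln (u k)|) m).
Proof.
move=> u0; rewrite /series /= expR_sum; apply: ler_prod => k _.
by rewrite ltW//= -[leLHS]lnK ?posrE// ler_expR ler_norm.
Qed.

(** Each quotient [t k / t k.+1] is at most the exponential of its distance to 1. Multiplying the
    first quotients bounds [t 0 / t k] by the exponential of a partial sum, hence of the whole
    series. *)
Lemma ratio_summable_lbound t : (forall k, 0 < t k) ->
  cvgn (series (fun k => `|t k / t k.+1 - 1|)) ->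
  exists2 c : R, 0 < c & forall k, c <= t k.
Proof.
move=> t0 ct; set r := fun k => _ in ct.
exists (t 0%N * expR (- limn (series r))); first by rewrite mulr_gt0 ?expR_gt0.
move=> k; rewrite expRN ler_pdivrMr ?expR_gt0//.
apply: (@le_trans _ _ (t k * expR (series r k))); last first.
  rewrite ler_pM2l// ler_expR; apply: series_le_limn => // j; exact: normr_ge0.
elim: k => [|k IH]; first by rewrite /series /= big_geq// expR0 mulr1.
apply: (le_trans IH); rewrite /series/= big_nat_recr//= expRD mulrA mulrAC.
rewrite ler_pM2r ?expR_gt0// -ler_pdivrMl// mulrC.
rewrite -[leLHS](subrK 1) addrC; apply: le_trans (expR_ge1Dx _).
by rewrite lerD2l ler_norm.
Qed.

(** The inequality [ln (1 + z) <= z] bounds [ln (y / x)] by [(y - x) / x]; using it for [b / a] and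
    for the inverse quotient controls both signs. *)
Lemma ler_norm_ln_div (c a b : R) : 0 < c -> c <= a -> c <= b ->
  `|ln (b / a)| <= c^-1 * `|a - b|.
Proof.
move=> c0 ca cb; have [a0 b0] := (lt_le_trans c0 ca, lt_le_trans c0 cb).
have aux (x y : R) : c <= x -> 0 < x -> 0 < y -> ln (y / x) <= c^-1 * `|y - x|.
  move=> cx x0 y0; rewrite -[y / x](subrK 1) addrC.
  apply: le_trans (le_ln1Dx _) _.
    by rewrite ltrBrDr addNr divr_gt0.
  rewrite -(divff (lt0r_neq0 x0)) -mulrBl mulrC.
  apply: le_trans (_ : x^-1 * `|y - x| <= _).
    by rewrite ler_wpM2l ?ler_norm// invr_ge0 ltW.
  by rewrite ler_wpM2r// lef_pV2.
rewrite ler_norml distrC aux// andbT.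
rewrite -[b / a]invrK lnV ?posrE ?invr_gt0 ?divr_gt0// lerN2 invf_div.
by rewrite distrC aux.
Qed.

Lemma cvg_series_ln_div (a b : nat -> R) (c : R) : 0 < c ->
  (forall k, c <= a k) -> (forall k, c <= b k) ->
  cvgn (series (fun k => `|a k - b k|)) ->
  cvgn (series (fun k => `|ln (b k / a k)|)).
Proof.
move=> c0 ca cb cab.
apply: (series_le_cvg (v_ := c^-1 *: (fun k => `|a k - b k|))).
- by [].
- by move=> k; rewrite mulr_ge0// invr_ge0 ltW.
- by move=> k; exact: ler_norm_ln_div.
- exact: is_cvg_seriesZ.
Qed.

End summable_sequences.

(** * Cylinders *)

Section word_cylinders.
Variable n : nat.
Implicit Types (x y z : words n) (A : set (words n)) (m : nat).

(** Position [m] is included: a prefix has [m + 1] letters and [m] transitions, which matches the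
    number of factors of [markov_weight]. *)
Definition agree m x y := forall k, (k <= m)%N -> letter y k = letter x k.

Definition same_prefix m x : set (words n) := [set y | agree m x y].

Definition prefix_determined m A := forall x y, agree m x y -> A x -> A y.

(** The empty set is added to obtain a pi-system, since two prefix sets are either disjoint or
    nested. *)
Definition prefix_sets : set (set (words n)) :=
  [set A | A = set0 \/ exists m x, A = same_prefix m x].

Lemma agree_sym m x y : agree m x y -> agree m y x.
Proof. by move=> xy k km; rewrite xy. Qed.

Lemma agree_trans m x y z : agree m x y -> agree m y z -> agree m x z.
Proof. by move=> xy yz k km; rewrite yz// xy. Qed.

Lemma agree_le m p x y : (m <= p)%N -> agree p x y -> agree m x y.
Proof. by move=> mp xy k km; apply: xy; exact: leq_trans mp. Qed.

Lemma same_prefix_determined m p x : (m <= p)%N ->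
  prefix_determined p (same_prefix m x).
Proof. by move=> mp y z /(agree_le mp) yz xy; exact: agree_trans yz. Qed.

Lemma setI_closed_prefix_sets : setI_closed prefix_sets.
Proof.
move=> A B [->|[m [x ->]]]; first by left; rewrite set0I.
move=> [->|[p [y ->]]]; first by left; rewrite setI0.
have [[z [xz yz]]|/nonemptyPn ->] :=
  pselect (same_prefix m x `&` same_prefix p y !=set0); last by left.
right; exists (maxn m p), z; apply/seteqP; split=> [w [xw yw] k|w zw].
  by rewrite leq_max => /orP[] km; [rewrite xw// xz|rewrite yw// yz].
split; [apply: agree_trans xz _|apply: agree_trans yz _];
  apply: agree_le zw; by rewrite ?leq_maxl ?leq_maxr.
Qed.

Definition word_of m (w : m.+1.-tuple 'I_n.+1) : words n :=
  fun k => nth ord0 w k.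

Definition prefix_of m x : m.+1.-tuple 'I_n.+1 := [tuple letter x i | i < m.+1].

Lemma agree_prefix_of m x : agree m x (word_of (prefix_of m x)).
Proof.
move=> k km; have km' : (k < m.+1)%N by [].
rewrite /letter /word_of -[k]/(val (Ordinal km')) -tnth_nth.
by rewrite tnth_mktuple.
Qed.

Lemma agree_word_of_inj m (w v : m.+1.-tuple 'I_n.+1) :
  agree m (word_of w) (word_of v) -> w = v.
Proof.
move=> wv; apply: eq_from_tnth => i; rewrite !(tnth_nth ord0).
by apply/esym; apply: (wv i); rewrite -ltnS.
Qed.

(** There are finitely many tuples, so this is a finite union; measurability and values of measures
    thereby reduce to prefix sets. *)
Lemma prefix_determinedE m A : prefix_determined m A ->
  A = \bigcup_(w in [set w : m.+1.-tuple 'I_n.+1 | A (word_of w)])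
    same_prefix m (word_of w).
Proof.
move=> Am; apply/seteqP; split=> [x Ax|x [w Aw wx]]; last exact: (Am _ _ wx Aw).
exists (prefix_of m x); first exact: (Am _ _ (@agree_prefix_of m x) Ax).
exact/agree_sym/agree_prefix_of.
Qed.

Lemma trivIset_same_prefix m (D : set (m.+1.-tuple 'I_n.+1)) :
  trivIset D (fun w => same_prefix m (word_of w)).
Proof.
move=> w v _ _ [x [wx vx]]; apply: (@agree_word_of_inj m).
exact: agree_trans (agree_sym vx).
Qed.

Lemma nbhs_same_prefix (x : word_space n) (U : set (word_space n)) :
  open U -> U x -> exists m, same_prefix m x `<=` U.
Proof.
move=> oU Ux; pose F := filter_from [set: nat] (fun m => same_prefix m x).
have FF : Filter F.
  apply: filter_from_filter; first by exists 0%N.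
  move=> i j _ _; exists (maxn i j) => // y xy; split; apply: agree_le xy.
    exact: leq_maxl.
  exact: leq_maxr.
have Fx : F --> x.
  (* The product topology is the supremum of the topologies induced by the projections, so
     convergence is tested on one coordinate [k], which [same_prefix k x] fixes. *)
  apply/cvg_sup => k V [W] [[Z] oZ <-] Zx ZV; exists k => // y xy.
  by apply: ZV; rewrite /= (_ : y k = x k)//; exact: (xy k (leqnn k)).
have [m _ mU] := Fx U (open_nbhs_nbhs (conj oU Ux)).
by exists m.
Qed.

Lemma open_letter k (a : 'I_n.+1) :
  open [set x : word_space n | x k = a].
Proof.
rewrite (_ : [set _ | _] = proj k @^-1` [set a])//.
apply: open_comp; last exact: discrete_open.
by move=> x _; exact: proj_continuous.
Qed.

Lemma measurable_letter k (a : 'I_n.+1) :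
  measurable [set x : words n | letter x k = a].
Proof. by apply: sub_sigma_algebra; exact: open_letter. Qed.

Lemma measurable_same_prefix m x : measurable (same_prefix m x).
Proof.
rewrite (_ : same_prefix m x =
    \bigcap_(k < m.+1) [set y | letter y k = letter x k]).
  by apply: bigcap_measurableType => k _; exact: measurable_letter.
by apply/seteqP; split=> y xy k; apply: xy.
Qed.

Lemma words_measurableE : @measurable _ (words n) = <<s prefix_sets >>.
Proof.
apply/seteqP; split; last first.
  apply: smallest_sub; first exact: sigma_algebra_measurable.
  move=> A [->|[m [x ->]]]; [exact: measurable0|exact: measurable_same_prefix].
(* [WT] carries the sigma-algebra generated by prefix sets. An open set is the countable union over
   [m] of the words whose prefix set lies inside it, and each term is a finite union of prefix
   sets. *)
pose WT := g_sigma_algebraType prefix_sets.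
apply: smallest_sub; first exact: smallest_sigma_algebra.
move=> U oU; rewrite (_ : U = \bigcup_m [set x | same_prefix m x `<=` U]).
  apply: (@bigcupT_measurable _ WT) => m.
  have /prefix_determinedE-> :
      prefix_determined m [set x | same_prefix m x `<=` U].
    by move=> x y xy xU z yz; apply: xU; exact: agree_trans yz.
  apply: (@fin_bigcup_measurable _ WT); first exact: finite_finset.
  by move=> w _; apply: sub_sigma_algebra; right; exists m, (word_of w).
apply/seteqP; split=> [x Ux|x [m _]].
  by have [m mU] := nbhs_same_prefix oU Ux; exists m.
by apply; move=> k.
Qed.

Lemma measurable_prefix_determined m A : prefix_determined m A -> measurable A.
Proof.
move=> /prefix_determinedE ->; apply: fin_bigcup_measurable => // w _.
exact: measurable_same_prefix.
Qed.

Lemma measurable_fun_prefix d (U : measurableType d) (h : words n -> U) m :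
  (forall x y, agree m x y -> h x = h y) -> measurable_fun setT h.
Proof.
move=> hm _ B mB; rewrite setTI; apply: (@measurable_prefix_determined m).
by move=> x y /hm; rewrite /preimage /= => ->.
Qed.

Lemma measurable_wshift : measurable_fun setT (@wshift n).
Proof.
apply: (measurability _ words_measurableE) => _ [A mA <-]; rewrite setTI.
case: mA => [->|[m [x ->]]]; first by rewrite preimage_set0.
apply: (@measurable_prefix_determined m.+1) => y z yz xy k km.
by have := yz k.+1 km; rewrite /letter /wshift => ->; exact: xy.
Qed.

Lemma eq_measure_prefix (R : realType)
    (m1 m2 : {measure set (words n) -> \bar R}) m A :
  (forall x, m1 (same_prefix m x) = m2 (same_prefix m x)) ->
  prefix_determined m A -> m1 A = m2 A.
Proof.
move=> m12 /prefix_determinedE ->.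
rewrite !measure_fin_bigcup//; try exact: finite_finset;
  do ?[exact: trivIset_same_prefix |
       by move=> w _; exact: measurable_same_prefix].
by apply: eq_fsbigr => w _; exact: m12.
Qed.

End word_cylinders.

(** * Change of density on L^2 *)

Section L2_ae.
Context d (T : measurableType d) (R : realType).
Variable mu : {measure set T -> \bar R}.

Lemma L2_ae_inj (u v : L2 mu) : {ae mu, forall x, u x = v x} -> u = v.
Proof. by move=> uv; rewrite -[u]reprK -[v]reprK; apply/eqP/L2_piP. Qed.

(** The representative of a class is an arbitrary choice, so the one of [a *: u + v] is related to
    those of [u] and [v] only almost everywhere. *)
Lemma L2_linE a (u v : L2 mu) :
  {ae mu, forall x, (a *: u + v : L2 mu) x = a * u x + v x}.
Proof.
have -> : a *: u + v = \pi_(L2 mu)%qT (a *: repr u + repr v).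
  by rewrite L2_piD -L2_scale_pi !reprK.
exact: L2_reprP.
Qed.

End L2_ae.

Section density.
Context d (T : measurableType d) (R : realType).

Lemma Lfun2P (m : {measure set T -> \bar R}) (f : T -> R) :
  f \in Lfun m 2%:E <->
  measurable_fun setT f /\ (\int[m]_x (f x ^+ 2)%:E < +oo)%E.
Proof.
split=> [f2|[mf f2]].
  split; first by move: f2 => /sub_Lfun_mfun; rewrite inE.
  have /integrableP[_] := Lfun2_integrable_sqr f2.
  by under eq_integral do rewrite /= ger0_norm ?sqr_ge0//.
rewrite inE; apply/andP; split; rewrite inE//= /finite_norm unlock /=.
apply: poweR_lty; apply: le_lt_trans f2; rewrite le_eqVlt; apply/orP; left.
apply/eqP; apply: eq_integral => x _.
by rewrite powR_mulrn// real_normK ?num_real.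
Qed.

Variables (mu nu : {finite_measure set T -> \bar R}) (rho : T -> R).
Hypotheses (mrho : measurable_fun setT rho) (rho_gt0 : forall x, 0 < rho x).
Hypothesis nuE : forall A, measurable A ->
  nu A = (\int[mu]_(x in A) (rho x)%:E)%E.

Let mrhoE : measurable_fun setT (fun x => (rho x)%:E).
Proof. exact/measurable_EFinP. Qed.

Lemma density_dominates : nu `<< mu.
Proof.
apply/null_content_dominatesP => A mA A0; rewrite [LHS]nuE//.
by apply: null_set_integral => //; exact: measurable_funTS.
Qed.

Lemma density_dominated : mu `<< nu.
Proof.
apply/null_content_dominatesP => A mA /(etrans (esym (nuE mA))) A0.
have : (\int[mu]_(x in A) `|(rho x)%:E| = 0)%E.
  by rewrite -A0; apply: eq_integral => x _; rewrite gee0_abs// lee_fin ltW.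
move/(ae_eq_integral_abs _ mA (measurable_funTS mrhoE)) => [B [mB B0 AB]].
apply/eqP; rewrite eq_le measure_ge0 andbT -[leRHS]B0 le_measure ?inE//.
move=> x Ax; apply: AB => /= /(_ Ax) [] /eqP.
by rewrite gt_eqF.
Qed.

(** The formula holds for the Radon-Nikodym derivative of [nu], and [rho] equals this derivative
    almost everywhere because both have the same integral over every measurable set. *)
Lemma ge0_integral_density (f : T -> \bar R) :
  measurable_fun setT f -> (forall x, (0 <= f x)%E) ->
  (\int[nu]_x f x = \int[mu]_x (f x * (rho x)%:E))%E.
Proof.
move=> mf f0; have numu := density_dominates.
rewrite -(Radon_Nikodym_SigmaFinite.change_of_variables numu)//.
have irn := Radon_Nikodym_SigmaFinite.f_integrable numu.
apply: ge0_ae_eq_integral => //.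
- by apply: emeasurable_funM => //; exact: measurable_int irn.
- exact: emeasurable_funM.
- by move=> x _; rewrite mule_ge0 ?Radon_Nikodym_SigmaFinite.f_ge0.
- by move=> x _; rewrite mule_ge0// lee_fin ltW.
- apply: ae_eqe_mul2l; apply: integral_ae_eq => // A _ mA.
  by rewrite -nuE// -Radon_Nikodym_SigmaFinite.f_integral.
Qed.

Lemma Rintegral_density (h : T -> R) : measurable_fun setT h ->
  \int[nu]_x (h x / rho x) = \int[mu]_x h x.
Proof.
move=> mh; rewrite /Rintegral; congr fine.
have mg : measurable_fun setT (fun x => (h x / rho x)%:E).
  apply/measurable_EFinP; apply: measurable_funM => //.
  rewrite (_ : (fun x => _) = (@powR R ^~ (-1)) \o rho).
    by apply: measurableT_comp => //; exact: measurable_powR.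
  by apply/funext => x; rewrite /= powR_inv1// ltW.
(* Positive and negative parts are treated separately: the positive factor [rho x] passes through
   the maximum with 0 and cancels the division. *)
rewrite integralE [RHS]integralE; congr (_ - _)%E.
- rewrite ge0_integral_density//; last exact: measurable_funepos.
  apply: eq_integral => x _; rewrite !funeposE -!EFin_max -EFinM.
  by rewrite maxr_pMl ?ltW// mul0r divfK// gt_eqF.
- rewrite ge0_integral_density//; last exact: measurable_funeneg.
  apply: eq_integral => x _; rewrite !funenegE -!EFinN -!EFin_max -EFinM.
  by rewrite maxr_pMl ?ltW// mul0r mulNr divfK// gt_eqF.
Qed.

Let msqrt : measurable_fun setT (fun x => Num.sqrt (rho x)).
Proof.
apply: measurableT_comp mrho; apply: continuous_measurable_fun.
exact: sqrt_continuous.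
Qed.

Lemma Lfun2_density (f : T -> R) : f \in Lfun mu 2%:E ->
  (fun x => (Num.sqrt (rho x))^-1 * f x) \in Lfun nu 2%:E.
Proof.
move=> /Lfun2P[mf f2]; apply/Lfun2P; have mg : measurable_fun setT
    (fun x => (Num.sqrt (rho x))^-1 * f x).
  apply: measurable_funM => //.
  rewrite (_ : (fun x => _) = (@powR R ^~ (-1)) \o (fun x => Num.sqrt (rho x))).
    by apply: measurableT_comp => //; exact: measurable_powR.
  by apply/funext => x; rewrite /= powR_inv1// sqrtr_ge0.
split=> //; rewrite ge0_integral_density//; last 2 first.
- by apply/measurable_EFinP; exact: measurable_funX.
- by move=> x; rewrite lee_fin sqr_ge0.
apply: le_lt_trans f2; rewrite le_eqVlt; apply/orP; left; apply/eqP.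
apply: eq_integral => x _; rewrite -EFinM exprMn exprVn sqr_sqrtr ?ltW//.
by rewrite mulrAC mulVf ?mul1r// gt_eqF.
Qed.

Lemma Lfun2_density_inv (f : T -> R) : f \in Lfun nu 2%:E ->
  (fun x => Num.sqrt (rho x) * f x) \in Lfun mu 2%:E.
Proof.
move=> /Lfun2P[mf f2]; apply/Lfun2P; split; first exact: measurable_funM.
move: f2; rewrite ge0_integral_density//; last 2 first.
- by apply/measurable_EFinP; exact: measurable_funX.
- by move=> x; rewrite lee_fin sqr_ge0.
apply: le_lt_trans; rewrite le_eqVlt; apply/orP; left; apply/eqP.
by apply: eq_integral => x _; rewrite -EFinM exprMn sqr_sqrtr ?ltW// mulrC.
Qed.

Fact sq_integrable_density (f : L2fun mu) :
  (fun x => ((Num.sqrt (rho x))^-1)%:C%C * f x) \in sq_integrable nu.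
Proof.
have /andP[fr fi] := L2fun_sq_integrable f; apply/andP; split.
- have := Lfun2_density fr; congr (_ \in Lfun _ _); apply/funext => x /=.
  by case: (f x) => a b /=; rewrite mul0r subr0.
- have := Lfun2_density fi; congr (_ \in Lfun _ _); apply/funext => x /=.
  by case: (f x) => a b /=; rewrite mul0r addr0.
Qed.

Fact sq_integrable_density_inv (f : L2fun nu) :
  (fun x => (Num.sqrt (rho x))%:C%C * f x) \in sq_integrable mu.
Proof.
have /andP[fr fi] := L2fun_sq_integrable f; apply/andP; split.
- have := Lfun2_density_inv fr; congr (_ \in Lfun _ _); apply/funext => x /=.
  by case: (f x) => a b /=; rewrite mul0r subr0.
- have := Lfun2_density_inv fi; congr (_ \in Lfun _ _); apply/funext => x /=.
  by case: (f x) => a b /=; rewrite mul0r addr0.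
Qed.

Definition density_op (u : L2 mu) : L2 nu :=
  \pi_(L2 nu)%qT (MkL2fun (sq_integrable_density (repr u))).

Lemma density_opE (u : L2 mu) :
  {ae nu, forall x, density_op u x = ((Num.sqrt (rho x))^-1)%:C%C * u x}.
Proof. exact: L2_reprP. Qed.

Let ae_nu (P : T -> Prop) : {ae mu, forall x, P x} -> {ae nu, forall x, P x}.
Proof.
have /null_content_dominatesP numu := density_dominates.
by move=> [A [mA A0 PA]]; exists A; split=> //; exact: numu.
Qed.

(** Linearity of representatives in [L2 mu] is known [mu]-almost everywhere; absolute continuity of
    [nu] transfers it to [nu], where the images are compared. *)
Fact density_op_linear : linear density_op.
Proof.
move=> a u v; apply: L2_ae_inj.
have Wlin : {ae nu, forall x, density_op (a *: u + v) x =
    ((Num.sqrt (rho x))^-1)%:C%C * (a * (u : L2 mu) x + (v : L2 mu) x)}.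
  move: (density_opE (a *: u + v)) (ae_nu (L2_linE a u v)).
  by apply: filterS2 => x -> ->.
have Wuv : {ae nu, forall x, (a *: density_op u + density_op v : L2 nu) x =
    a * (((Num.sqrt (rho x))^-1)%:C%C * (u : L2 mu) x) +
    ((Num.sqrt (rho x))^-1)%:C%C * (v : L2 mu) x}.
  move: (L2_linE a (density_op u) (density_op v)).
  move: (density_opE u) (density_opE v).
  by apply: filterS3 => x + + -> => -> ->.
by move: Wlin Wuv; apply: filterS2 => x -> ->; rewrite mulrDr mulrCA.
Qed.

HB.instance Definition _ :=
  GRing.isLinear.Build _ _ _ _ density_op density_op_linear.

(** The two factors of the inner product contribute [1 / rho], which the change of density absorbs.
    A preimage of [v] is the class of [v] multiplied by the square root of [rho]. *)
Lemma density_op_unitary :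
  unitary_op (@L2_dot _ _ _ mu) (@L2_dot _ _ _ nu) density_op.
Proof.
split=> [u v|v].
  rewrite -[LHS]/(L2_dot (density_op u) (density_op v)) -[RHS]/(L2_dot u v).
  rewrite /density_op L2_dot_pi /L2_dot /cintegral.
  have /= [/measurable_int/measurable_EFinP mr
           /measurable_int/measurable_EFinP mi] :=
    cintegrableM (repr u) (repr v).
  rewrite -(Rintegral_density mr) -(Rintegral_density mi) /L2_repr.
  have e x : ((Num.sqrt (rho x))^-1)%:C%C * repr u x *
      (((Num.sqrt (rho x))^-1)%:C%C * repr v x)^*%C =
      ((rho x)^-1)%:C%C * (repr u x * (repr v x)^*%C).
    have <- : (Num.sqrt (rho x))^-1 * (Num.sqrt (rho x))^-1 = (rho x)^-1.
      by rewrite -invfM -expr2 sqr_sqrtr// ltW.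
    case: (repr u x) (repr v x) => [a b] [c e].
    by apply/eqP; rewrite eq_complex /=; apply/andP; split; apply/eqP; ring.
  congr (_ +i* _)%C; apply: eq_Rintegral => x _ /=; rewrite e;
    by case: (_ * _^*%C) => a b /=; rewrite mul0r ?subr0 ?addr0 mulrC.
exists (\pi_(L2 mu)%qT (MkL2fun (sq_integrable_density_inv (repr v)))).
set u := \pi_(L2 mu)%qT _; apply: L2_ae_inj.
have Eu := ae_nu (L2_reprP (MkL2fun (sq_integrable_density_inv (repr v)))).
move: (density_opE u) Eu; apply: filterS2 => x -> ->.
by rewrite /= mulrA -rmorphM /= mulVf ?mul1r// gt_eqF// sqrtr_gt0.
Qed.

End density.

(** * Densities of Markov measures *)

Section density_measure.
Context d (T : measurableType d) (R : realType).
Variables (mu : {measure set T -> \bar R}) (rho : T -> R).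
Hypotheses (mrho : measurable_fun setT rho) (rho0 : forall x, 0 <= rho x).

(* The proofs are arguments so that the measure structure can be inferred. *)
Definition density_measure
    of measurable_fun setT rho & (forall x, 0 <= rho x) :=
  fun A => (\int[mu]_(x in A) (rho x)%:E)%E.

Local Notation nu := (density_measure mrho rho0).

Let nu0 : nu set0 = 0%E.
Proof. by rewrite /density_measure integral_set0. Qed.

Let nu_ge0 A : (0 <= nu A)%E.
Proof. by apply: integral_ge0 => x _; rewrite lee_fin. Qed.

Let nu_sigma_additive : semi_sigma_additive nu.
Proof.
apply: semi_sigma_additive_nng_induced; first exact/measurable_EFinP.
by move=> x; rewrite lee_fin.
Qed.

HB.instance Definition _ :=
  isMeasure.Build _ _ _ nu nu0 nu_ge0 nu_sigma_additive.

End density_measure.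

Section markov_weight.
Variables (R : realType) (n : nat).
Implicit Types (l : 'rV[R]_n.+1) (T : nat -> 'M[R]_n.+1) (x : words n).

(** The mass of the cylinder given by the first [m + 1] letters of [x]; taking an infinite word as
    argument lets [m] tend to infinity along a fixed [x]. *)
Definition markov_weight l T m x : R :=
  l 0 (letter x 0) * \prod_(0 <= k < m) T k (letter x k) (letter x k.+1).

Lemma markov_weight_agree l T m x y : agree m x y ->
  markov_weight l T m x = markov_weight l T m y.
Proof.
move=> xy; rewrite /markov_weight xy//; congr (_ * _).
by apply: eq_big_nat => k km; rewrite !xy// ltnW// (andP km).2.
Qed.

Lemma markov_weight_gt0 l T m x : (forall i, 0 < l 0 i) ->
  (forall k i j, 0 < T k i j) -> 0 < markov_weight l T m x.
Proof. by move=> l0 T0; rewrite mulr_gt0// prodr_gt0. Qed.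

Lemma markov_measure_same_prefix l T (mu : probability (words n) R) m x :
  markov_measure l T mu -> mu (same_prefix m x) = (markov_weight l T m x)%:E.
Proof.
move=> muP.
rewrite (_ : same_prefix m x = cylinder (prefix_of m x)); last first.
  apply/seteqP; split=> [y xy k|y xy k km].
    by rewrite tnth_mktuple; apply: xy; rewrite -ltnS.
  by have := xy (Ordinal (km : (k < m.+1)%N)); rewrite tnth_mktuple.
rewrite muP /markov_weight tnth_mktuple big_mkord; congr (_ * _)%:E.
by apply: eq_bigr => k _; rewrite !tnth_mktuple.
Qed.

End markov_weight.

Section markov_density.
Variables (R : realType) (n : nat).
Variables (l l' : 'rV[R]_n.+1) (T T' : nat -> 'M[R]_n.+1).
Hypotheses (l_gt0 : forall i, 0 < l 0 i) (l'_gt0 : forall i, 0 < l' 0 i).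
Hypothesis T_gt0 : forall k i j, 0 < T k i j.
Hypothesis T'_gt0 : forall k i j, 0 < T' k i j.
Hypothesis lnTT' :
  forall i j, cvgn (series (fun k => `|ln (T' k i j / T k i j)|)).
Implicit Types x : words n.

Definition likelihood_ratio m x : R :=
  markov_weight l' T' m x / markov_weight l T m x.

Definition markov_density x : R := limn (likelihood_ratio ^~ x).

Let u x k :=
  T' k (letter x k) (letter x k.+1) / T k (letter x k) (letter x k.+1).

Let u_gt0 x k : 0 < u x k. Proof. exact: divr_gt0. Qed.

(** Summing over all entries gives a bound on the logarithmic increments that no longer depends on
    the word. *)
Let b k := \sum_i \sum_j `|ln (T' k i j / T k i j)|.

Let ln_u_le x k : `|ln (u x k)| <= b k.
Proof.
rewrite /b (bigD1 (letter x k))//= (bigD1 (letter x k.+1))//= -addrA lerDl.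
by rewrite addr_ge0// ?sumr_ge0// => i _; rewrite ?sumr_ge0.
Qed.

Let cvg_b : cvgn (series b).
Proof.
apply: cvg_series_sum => [i k|i]; first exact: sumr_ge0.
exact: cvg_series_sum.
Qed.

Let b_ge0 k : 0 <= b k.
Proof. by rewrite sumr_ge0// => i _; rewrite sumr_ge0. Qed.

Let lrE m x : likelihood_ratio m x =
  l' 0 (letter x 0) / l 0 (letter x 0) * \prod_(0 <= k < m) u x k.
Proof. by rewrite /likelihood_ratio /markov_weight invfM mulrACA prodf_div. Qed.

Lemma likelihood_ratio_gt0 m x : 0 < likelihood_ratio m x.
Proof. by rewrite divr_gt0// markov_weight_gt0. Qed.

Lemma likelihood_ratio_ubound : exists M, forall m x, likelihood_ratio m x <= M.
Proof.
exists ((\sum_i l' 0 i / l 0 i) * expR (limn (series b))) => m x; rewrite lrE.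
apply: ler_pM.
- by rewrite divr_ge0// ltW.
- by rewrite prodr_ge0// => k _; rewrite ltW.
- rewrite (bigD1 (letter x 0))//= lerDl sumr_ge0// => i _.
  by rewrite divr_ge0// ltW.
- apply: le_trans (prod_le_series_ln _ (u_gt0 x)) _; rewrite ler_expR.
  apply: (le_trans (y := series b m)); last exact: series_le_limn.
  by rewrite ler_sum// => k _; exact: ln_u_le.
Qed.

Let lr_cvg x : exists2 p : R, 0 < p & likelihood_ratio ^~ x @ \oo --> p.
Proof.
have [|p p0 up] := prod_cvg (u_gt0 x).
  by apply: (series_le_cvg (v_ := b)).
exists (l' 0 (letter x 0) / l 0 (letter x 0) * p).
  by rewrite mulr_gt0// divr_gt0.
under eq_fun do rewrite lrE.
exact: cvgMr.
Qed.

Lemma cvg_likelihood_ratio x : likelihood_ratio ^~ x @ \oo --> markov_density x.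
Proof. by have [p _ cp] := lr_cvg x; apply/cvg_ex; exists p. Qed.

Lemma markov_density_gt0 x : 0 < markov_density x.
Proof. by have [p p0 /cvg_lim] := lr_cvg x; rewrite /markov_density => ->. Qed.

Let measurable_lr m : measurable_fun setT (likelihood_ratio m).
Proof.
apply: (@measurable_fun_prefix _ _ _ _ m) => x y xy.
by rewrite /likelihood_ratio !(markov_weight_agree _ _ xy).
Qed.

Lemma measurable_markov_density : measurable_fun setT markov_density.
Proof.
apply: measurable_fun_cvg measurable_lr _ => x _; exact: cvg_likelihood_ratio.
Qed.

Variables mu mu' : probability (words n) R.
Hypotheses (muP : forall m x, mu (same_prefix m x) = (markov_weight l T m x)%:E)
  (mu'P : forall m x, mu' (same_prefix m x) = (markov_weight l' T' m x)%:E).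

(** On a prefix set of level [p] the ratio is the constant quotient of the two masses, so the
    measure with this density agrees with [mu'] there, and by additivity on the coarser levels. *)
Let integral_lr m p x : (m <= p)%N ->
  (\int[mu]_(y in same_prefix m x) (likelihood_ratio p y)%:E)%E =
  mu' (same_prefix m x).
Proof.
move=> mp.
pose nu := density_measure mu (measurable_lr p)
  (fun y => ltW (likelihood_ratio_gt0 p y)).
rewrite -[LHS]/(nu (same_prefix m x)).
apply: (@eq_measure_prefix _ _ _ _ p); last exact: same_prefix_determined.
move=> y; rewrite /nu /density_measure /=.
transitivity (\int[mu]_(z in same_prefix p y) (likelihood_ratio p y)%:E)%E.
  apply: eq_integral => z /set_mem yz.
  by rewrite /likelihood_ratio !(markov_weight_agree _ _ yz).
rewrite integral_cst; last exact: measurable_same_prefix.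
rewrite mu'P [X in (_ * X)%E]muP -EFinM divfK//.
by rewrite gt_eqF// markov_weight_gt0.
Qed.

Lemma markov_density_integral A : measurable A ->
  mu' A = (\int[mu]_(x in A) (markov_density x)%:E)%E.
Proof.
move=> mA; pose nu := density_measure mu measurable_markov_density
  (fun y => ltW (markov_density_gt0 y)).
rewrite -[RHS]/(nu A).
(* The covering sequence fixes only the first letter; [inord] takes a default value once [k] exceeds
   the alphabet, so the sets repeat but still cover. *)
refine (@measure_unique _ R (words n) (prefix_sets (n:=n))
  (fun k : nat => same_prefix 0 ((fun=> inord k) : words n))
  _ _ _ _ mu' nu _ _ A mA).
- exact: words_measurableE.
- exact: setI_closed_prefix_sets.
- by move=> k; right; exists 0%N, (fun=> inord k).
- apply/seteqP; split=> // x _; exists (letter x 0) => // k.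
  by rewrite leqn0 => /eqP ->; rewrite /letter inord_val.
- move=> _ [->|[m [x ->]]]; first by rewrite !measure0.
  have [M lrM] := likelihood_ratio_ubound.
  have mC := measurable_same_prefix m x.
  have [] := @dominated_convergence _ _ _ mu _ mC
    (fun p y => (likelihood_ratio p y)%:E) (fun y => (markov_density y)%:E)
    (fun=> M%:E).
  + by move=> p; apply/measurable_EFinP; exact: measurable_funTS.
  + apply/measurable_EFinP; apply: measurable_funTS.
    exact: measurable_markov_density.
  + apply: aeW => y _; apply: cvg_EFin; first exact: nearW.
    exact: cvg_likelihood_ratio.
  + exact: finite_measure_integrable_cst.
  + apply: aeW => y p _; rewrite lee_fin ger0_norm ?lrM// ltW//.
    exact: likelihood_ratio_gt0.
  move=> _ _ /cvg_lim h; apply/esym/(etrans (esym (h _))) => //.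
  (* The integrals over a prefix set of level [m] do not vary once [p >= m]. *)
  apply/cvg_lim => //; apply: cvg_near_cst.
  by exists m => // p /= mp; exact: integral_lr.
- move=> k; rewrite (le_lt_trans (probability_le1 _ _)) ?ltry//.
  exact: measurable_same_prefix.
Qed.

End markov_density.

(** * Quasi-stationary data and the shift *)

HB.instance Definition _ (n : nat) :=
  isMeasurableFun.Build _ _ _ _ (@wshift n) (@measurable_wshift n).

Section quasi_stationary_data.
Variables (R : realType) (n : nat).
Implicit Types (l : 'rV[R]_n.+1) (T : nat -> 'M[R]_n.+1).

(* The words ijij... and jiji... realize the pair (i, j) at even and at odd
   positions respectively. *)
Lemma quasi_stationary_entry T i j : quasi_stationary T ->
  cvgn (series (fun k => `|T k i j / T k.+1 i j - 1|)).
Proof.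
move=> qT; pose x : words n := fun k => if odd k then j else i.
pose y : words n := fun k => if odd k then i else j.
apply: (series_le_cvg _ _ _ (is_cvg_seriesD (qT x) (qT y))) => // k.
  by rewrite fctE addr_ge0.
rewrite fctE /markov_ratio /letter /x /y /=.
by case: (odd k) => /=; rewrite ?lerDl ?lerDr.
Qed.

Lemma markov_data_le1 l T k i j : markov_data l T -> T k i j <= 1.
Proof.
move=> [_ _ T0 T1 _]; rewrite -(T1 k i) (bigD1 j)//= lerDl.
by rewrite sumr_ge0// => h _; rewrite ltW.
Qed.

Lemma quasi_stationary_lbound l T i j : markov_data l T -> quasi_stationary T ->
  exists2 c : R, 0 < c & forall k, c <= T k i j.
Proof.
move=> [_ _ T0 _ _] qT; apply: ratio_summable_lbound => //.
exact: quasi_stationary_entry.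
Qed.

(** Entries are at most 1, so clearing the denominator [T k.+1 i j] can only decrease the absolute
    value. *)
Lemma quasi_stationary_dist l T i j : markov_data l T -> quasi_stationary T ->
  cvgn (series (fun k => `|T k i j - T k.+1 i j|)).
Proof.
move=> dT qT; have [_ _ T0 _ _] := dT.
apply: series_le_cvg (@quasi_stationary_entry _ i j qT) => // k.
have -> : T k i j / T k.+1 i j - 1 = (T k i j - T k.+1 i j) / T k.+1 i j.
  by rewrite mulrBl divff// gt_eqF.
rewrite normrM ler_peMr// normfV gtr0_norm// invf_ge1//.
exact: markov_data_le1 dT.
Qed.

Lemma quasi_stationary_ln l T i j : markov_data l T -> quasi_stationary T ->
  cvgn (series (fun k => `|ln (T k i j / T k.+1 i j)|)).
Proof.
move=> dT qT; have [c c0 cT] := quasi_stationary_lbound i j dT qT.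
apply: (cvg_series_ln_div c0) => //.
by under eq_fun do rewrite distrC; exact: quasi_stationary_dist dT qT.
Qed.

(** This orientation gives the density of the shifted sequence relative to [T], for the image under
    the shift; the opposite one gives the convergence of [markov_F]. *)
Lemma quasi_stationary_ln_rev l T i j : markov_data l T -> quasi_stationary T ->
  cvgn (series (fun k => `|ln (T k.+1 i j / T k i j)|)).
Proof.
move=> dT qT; have [c c0 cT] := quasi_stationary_lbound i j dT qT.
by apply: (cvg_series_ln_div c0) => //; exact: quasi_stationary_dist dT qT.
Qed.

Lemma quasi_stationary_ln_div l T l' T' i j :
  markov_data l T -> quasi_stationary T ->
  markov_data l' T' -> quasi_stationary T' ->
  cvgn (series (fun k => `|T k i j - T' k i j|)) ->
  cvgn (series (fun k => `|ln (T' k i j / T k i j)|)).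
Proof.
move=> dT qT dT' qT'; have [c c0 cT] := quasi_stationary_lbound i j dT qT.
have [c' c'0 cT'] := quasi_stationary_lbound i j dT' qT'.
apply: (@cvg_series_ln_div _ _ _ (Num.min c c')) => [|k|k].
- by rewrite lt_min c0.
- by rewrite ge_min cT.
- by rewrite ge_min cT' orbT.
Qed.

End quasi_stationary_data.

(** * The shift: image measure, nonsingularity and the cocycle identity *)

Section shift.
Variables (R : realType) (n : nat).
Implicit Types (l : 'rV[R]_n.+1) (T : nat -> 'M[R]_n.+1) (x : words n).

(** The preimage splits according to the letter removed by the shift, and summing over this letter
    turns [l *m T 0] back into [l]. *)
Lemma distribution_wshift l T (mu : probability (words n) R) m x :
  l *m T 0%N = l ->
  (forall m x, mu (same_prefix m x) = (markov_weight l T m x)%:E) ->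
  distribution mu (@wshift n) (same_prefix m x) =
    (markov_weight l (fun k => T k.+1) m x)%:E.
Proof.
move=> lT muP; pose cons i : words n := fun k => if k is k'.+1 then x k' else i.
have -> : distribution mu (@wshift n) (same_prefix m x) =
    mu (\big[setU/set0]_(i < n.+1) same_prefix m.+1 (cons i)).
  rewrite /distribution /pushforward; congr (mu _).
  rewrite -bigcup_seq; apply/seteqP; split=> [y xy|y [i _ iy] k km].
    exists (letter y 0); first by rewrite /= mem_index_enum.
    by move=> [//|k] km; exact: xy.
  exact: (iy k.+1).
rewrite measure_bigsetU_ord; last 2 first.
- by move=> i; exact: measurable_same_prefix.
- move=> i j _ _ [y [iy jy]].
  by rewrite -[LHS](iy 0%N)// (jy 0%N).
transitivity (\sum_i (markov_weight l T m.+1 (cons i))%:E)%E.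
  by apply: eq_bigr => i _; exact: muP.
rewrite sumEFin; congr EFin; rewrite /markov_weight -{2}lT mxE mulr_suml.
by apply: eq_bigr => i _; rewrite big_nat_recl//= mulrA.
Qed.

(** The image of [mu] under the shift has a density with respect to [mu], so the preimage of a null
    set is null. *)
Lemma wshift_nonsingular l T (mu : probability (words n) R) :
  markov_data l T -> quasi_stationary T ->
  (forall m x, mu (same_prefix m x) = (markov_weight l T m x)%:E) ->
  forall P : words n -> Prop,
  {ae mu, forall x, P x} -> {ae mu, forall x, P (wshift x)}.
Proof.
move=> dT qT muP P; have [l0 _ T0 _ lT] := dT.
pose nu := distribution mu (@wshift n).
have nuE := markov_density_integral l0 l0 T0 (fun k => T0 k.+1)
  (fun i j => quasi_stationary_ln_rev dT qT) muP
  (fun m x => distribution_wshift m x lT muP).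
have /null_content_dominatesP numu := density_dominates (mu := mu) (nu := nu)
  (measurable_markov_density l0 l0 T0 (fun k => T0 k.+1)
    (fun i j => quasi_stationary_ln_rev dT qT)) nuE.
move=> [A [mA A0 PA]]; exists (@wshift n @^-1` A); split.
- by rewrite -[X in measurable X]setTI; exact: measurable_wshift.
- exact: numu.
- by move=> x; exact: PA.
Qed.

(** The limit is the quantity under the square root in [markov_f]; isolating the first transition of
    [x] leaves the partial products of [markov_F]. *)
Lemma cvg_markov_f_sqr l T x : markov_data l T -> quasi_stationary T ->
  (fun m => markov_weight l T m (wshift x) / markov_weight l T m.+1 x) @ \oo -->
  l 0 (letter x 1) / (l 0 (letter x 0) * T 0%N (letter x 0) (letter x 1)) *
    markov_F T (wshift x).
Proof.
move=> dT qT; have [l0 _ T0 _ _] := dT.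
pose T1 k := T k.+1.
(* F is the density of the data (l, T) relative to the shifted data (l, T1). *)
have -> : markov_F T (wshift x) = markov_density l l T1 T (wshift x).
  rewrite /markov_F /markov_density; congr (lim (_ @ \oo)); apply/funext => m.
  rewrite /likelihood_ratio /markov_weight invfM mulrACA divff ?gt_eqF// mul1r.
  by rewrite -prodf_div.
rewrite (_ : (fun m => _) = (fun m => l 0 (letter x 1) /
    (l 0 (letter x 0) * T 0%N (letter x 0) (letter x 1)) *
    likelihood_ratio l l T1 T m (wshift x))).
  apply: cvgMr; apply: cvg_likelihood_ratio => //.
    by move=> k i j; exact: T0.
  by move=> i j; exact: quasi_stationary_ln dT qT.
apply/funext => m; rewrite /likelihood_ratio {2 4}/markov_weight.
(* Both denominators contain the product [P] of the transitions of [x] after the first one, and both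
   numerators are [w]. *)
rewrite big_nat_recl//=; set P := \prod_(0 <= k < m) _.
set w := markov_weight _ _ _ _.
have P0 : P != 0 by rewrite gt_eqF// prodr_gt0// => k _; exact: T0.
rewrite -[letter (wshift x) 0]/(letter x 1).
by field; rewrite P0 !gt_eqF.
Qed.

(** Before the limit both sides equal the primed weight of [wshift x] at level [m] divided by the
    unprimed weight of [x] at level [m + 1]. *)
Lemma markov_density_cocycle l T l' T' x :
  markov_data l T -> quasi_stationary T ->
  markov_data l' T' -> quasi_stationary T' ->
  (forall i j, cvgn (series (fun k => `|T k i j - T' k i j|))) ->
  l 0 (letter x 1) / (l 0 (letter x 0) * T 0%N (letter x 0) (letter x 1)) *
    markov_F T (wshift x) * markov_density l l' T T' (wshift x) =
  l' 0 (letter x 1) / (l' 0 (letter x 0) * T' 0%N (letter x 0) (letter x 1)) *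
    markov_F T' (wshift x) * markov_density l l' T T' x.
Proof.
move=> dT qT dT' qT' TT'.
have [l0 _ T0 _ _] := dT; have [l'0 _ T'0 _ _] := dT'.
have lr_cvg y := cvg_likelihood_ratio l0 l'0 T0 T'0
  (fun i j => quasi_stationary_ln_div dT qT dT' qT' (TT' i j)) y.
have lhs := cvgM (cvg_markov_f_sqr (x := x) dT qT) (lr_cvg (wshift x)).
(* The index is shifted because [x] has one letter more than [wshift x] for the same final
   letter. *)
have lr_cvgS : (fun m => likelihood_ratio l l' T T' m.+1 x) @ \oo -->
  markov_density l l' T T' x.
  by rewrite (cvg_shiftS (likelihood_ratio l l' T T' ^~ x)); exact: lr_cvg.
have rhs := cvgM (cvg_markov_f_sqr (x := x) dT' qT') lr_cvgS.
have w0 m y := gt_eqF (markov_weight_gt0 m y l0 T0).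
have w'0 m y := gt_eqF (markov_weight_gt0 m y l'0 T'0).
rewrite -(cvg_lim _ (lhs _))// -(cvg_lim _ (rhs _))//; congr (lim (_ @ \oo)).
apply/funext => m; rewrite /likelihood_ratio /=.
by field; rewrite !(w0, w'0).
Qed.

End shift.

(* The number N >= 2 of letters is n.+2. *)
Theorem corollary4p3 (R : realType) (n : nat)
    (l l' : 'rV[R]_n.+2) (T T' : nat -> 'M[R]_n.+2)
    (mu mu' : probability (words n.+1) R) :
  markov_data l T -> markov_measure l T mu -> quasi_stationary T ->
  markov_data l' T' -> markov_measure l' T' mu' -> quasi_stationary T' ->
  (forall i j, cvgn (series (fun k => `|T k i j - T' k i j|))) ->
  (mu `<< mu' /\ mu' `<< mu) /\
  (forall (S : cuntz_rep n.+2 (@L2_dot _ (words n.+1) R mu))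
          (S' : cuntz_rep n.+2 (@L2_dot _ (words n.+1) R mu')),
    associated_rep l T S -> associated_rep l' T' S' -> rep_equiv S S').
Proof.
move=> dT muT qT dT' muT' qT' TT'.
have [l0 _ T0 _ _] := dT; have [l'0 _ T'0 _ _] := dT'.
have muP m x := markov_measure_same_prefix m x muT.
have mu'P m x := markov_measure_same_prefix m x muT'.
have lnTT' i j := quasi_stationary_ln_div dT qT dT' qT' (TT' i j).
pose rho := markov_density l l' T T'.
have mrho : measurable_fun setT rho :=
  measurable_markov_density l0 l'0 T0 T'0 lnTT'.
have rho0 : forall x, 0 < rho x := markov_density_gt0 l0 l'0 T0 T'0 lnTT'.
have mu'E : forall A, measurable A ->
    mu' A = (\int[mu]_(x in A) (rho x)%:E)%E :=
  markov_density_integral l0 l'0 T0 T'0 lnTT' muP mu'P.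
have dom := density_dominates mrho mu'E.
split; first by split=> //; exact: density_dominated mrho rho0 mu'E.
move=> S S' SP S'P; exists (density_op mrho rho0 mu'E).
  exact: density_op_unitary.
move=> j u; apply: L2_ae_inj.
set W := density_op mrho rho0 mu'E.
have WE := density_opE mrho rho0 mu'E.
have SE : {ae mu', forall x, (S j u : L2 mu) x =
    (markov_f l T j x)%:C%C * (u : L2 mu) (wshift x)}.
  have [A [mA A0 PA]] := SP j u; exists A; split=> //.
  by move/null_content_dominatesP : dom; exact.
(* [S'] evaluates [W u] at the shifted word, so the almost everywhere formula for [W u] is pulled
   back by the shift. *)
have WsE := wshift_nonsingular dT' qT' mu'P (WE u).
have lhs : {ae mu', forall x, W (S j u) x = ((Num.sqrt (rho x))^-1)%:C%C *
    ((markov_f l T j x)%:C%C * (u : L2 mu) (wshift x))}.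
  by move: (WE (S j u)) SE; apply: filterS2 => x -> ->.
have rhs : {ae mu', forall x, (S' j (W u) : L2 mu') x =
    (markov_f l' T' j x)%:C%C *
    (((Num.sqrt (rho (wshift x)))^-1)%:C%C * (u : L2 mu) (wshift x))}.
  by move: (S'P j (W u)) WsE; apply: filterS2 => x -> ->.
move: lhs rhs; apply: filterS2 => x -> ->; rewrite !mulrA -!rmorphM /=.
congr (_%:C%C * _); rewrite /markov_f.
(* The square root of the cocycle identity, cross-multiplied, is the equality of the two
   coefficients of [u (wshift x)]. *)
have := markov_density_cocycle x dT qT dT' qT' TT'.
rewrite -/rho => /(congr1 Num.sqrt).
rewrite !(mulrC _ (rho _)) [LHS]sqrtrM ?[RHS]sqrtrM ?(ltW (rho0 _))// => e.
have r0 y : Num.sqrt (rho y) != 0 by rewrite gt_eqF// sqrtr_gt0.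
(* The indicator of the first letter is common to both sides and splits off. *)
rewrite mulrCA -[RHS]mulrA; congr (_ * _).
by apply/eqP; rewrite mulrC eqr_div// mulrC e mulrC.
Qed.
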